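(* Let $A,B\in\mathbb{C}^{n\times n}$. For a matrix $X\in\mathbb{C}^{n\times n}$ the following statements are equivalent: (a) $X=A^{(B)}$; (b) $X$ satisfies the equations $XAX=X$, $AX=A(ABB^\dagger)^\dagger$, $XA=(ABB^\dagger)^\dagger A$; (c) $X$ satisfies the system $AX=P_{AB}$, $R(X)\subset R(BB^\dagger A^* )$.
   Context: $R(M)$, $M^*$, $M^\dagger$ denote the range, conjugate transpose and Moore-Penrose inverse of a complex matrix $M$, and $P_M:=MM^\dagger$. For $A,B\in\mathbb{C}^{n\times n}$, the generalized inverse of $A$ with respect to $B$ is $A^{(B)}:=(ABB^\dagger)^\dagger$. *)

(* Defs.v *)
From mathcomp Require Import all_boot all_order all_algebra.
From mathcomp Require Import spectral sesquilinear complex.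
From mathcomp Require Import classical_sets reals.
Set Implicit Arguments.
Unset Strict Implicit.
Unset Printing Implicit Defensive.

Import Order.TTheory GRing.Theory Num.Theory.

#[global] Open Scope ring_scope.
#[global] Open Scope sesquilinear_scope.

Section MoorePenrose.
Variable C : numClosedFieldType.
Implicit Types m n : nat.

Definition penrose m n (A : 'M[C]_(m, n)) (X : 'M[C]_(n, m)) : bool :=
  [&& A *m X *m A == A,
      X *m A *m X == X,
      (A *m X)^t* == A *m X
    & (X *m A)^t* == X *m A].

Lemma adjmx_mul m n p (A : 'M[C]_(m, n)) (B : 'M[C]_(n, p)) :
  (A *m B)^t* = B^t* *m A^t*.
Proof. by rewrite trmx_mul map_mxM. Qed.

Lemma mulmx_adj_eq0 m n (A : 'M[C]_(m, n)) : A *m A^t* = 0 -> A = 0.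
Proof.
move=> A0; apply/row_matrixP => i; rewrite row0.
apply/eqP; apply/negPn/negP => /(@dotmx_is_dotmx C n).
rewrite dotmxE.
have -> : row i A *m (row i A)^t* = row i (A *m A^t*) *m (delta_mx 0 i)^t*.
  by rewrite row_mul !rowE adjmx_mul !mulmxA.
by rewrite A0 row0 mul0mx mxE ltxx.
Qed.

Lemma gram_unit m n (G : 'M[C]_(m, n)) : row_free G -> G *m G^t* \in unitmx.
Proof.
move=> Gfree; rewrite -row_free_unit -kermx_eq0; set K := kermx _.
have K0 : (K *m G) *m (K *m G)^t* = 0.
  by rewrite adjmx_mul !mulmxA -(mulmxA K) mulmx_ker mul0mx.
by apply/eqP; apply: (row_free_inj Gfree); rewrite (mulmx_adj_eq0 K0) mul0mx.
Qed.

Lemma adjmx_inv n (A : 'M[C]_n) : (invmx A)^t* = invmx (A^t*).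
Proof. by rewrite trmx_inv map_invmx. Qed.

Lemma penrose_factor m r n (F : 'M[C]_(m, r)) (G : 'M[C]_(r, n)) :
  row_full F -> row_free G -> exists X, penrose (F *m G) X.
Proof.
move=> Ffull Gfree; pose P := G *m G^t*; pose Q := F^t* *m F.
have Pu : P \in unitmx by rewrite gram_unit.
have Qu : Q \in unitmx.
  rewrite /Q -{2}[F]trmxCK gram_unit //.
  by rewrite /row_free mxrank_map mxrank_tr -/(row_full F).
have Ph : P^t* = P by rewrite adjmx_mul trmxCK.
have Qh : Q^t* = Q by rewrite adjmx_mul trmxCK.
pose X := G^t* *m invmx P *m invmx Q *m F^t*.
have AX : F *m G *m X = F *m invmx Q *m F^t*.
  by rewrite /X !mulmxA -(mulmxA F G) -/P -(mulmxA F P) mulmxV // mulmx1.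
have XA : X *m (F *m G) = G^t* *m invmx P *m G.
  by rewrite /X !mulmxA -(mulmxA _ _ F) -/Q -(mulmxA _ _ Q) mulVmx // mulmx1.
exists X; apply/and4P; split; apply/eqP.
- by rewrite AX !mulmxA -(mulmxA _ _ F) -/Q -(mulmxA _ _ Q) mulVmx // mulmx1.
- by rewrite XA /X !mulmxA -(mulmxA _ G) -/P -(mulmxA _ _ P) mulVmx // mulmx1.
- by rewrite AX !adjmx_mul trmxCK adjmx_inv Qh mulmxA.
- by rewrite XA !adjmx_mul trmxCK adjmx_inv Ph mulmxA.
Qed.

Lemma penrose_exists m n (A : 'M[C]_(m, n)) : exists X, penrose A X.
Proof.
have := penrose_factor (col_base_full A) (row_base_free A).
by rewrite mulmx_base.
Qed.

Lemma penrose_uniq m n (A : 'M[C]_(m, n)) X Y :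
  penrose A X -> penrose A Y -> X = Y.
Proof.
case/and4P=> /eqP X1 /eqP X2 /eqP X3 /eqP X4.
case/and4P=> /eqP Y1 /eqP Y2 /eqP Y3 /eqP Y4.
have AXY : A *m X = A *m Y.
  by rewrite -[LHS]X3 -{1}Y1 -(mulmxA _ A X) adjmx_mul X3 Y3 mulmxA X1.
have XAY : X *m A = Y *m A.
  by rewrite -[LHS]X4 -{1}Y1 -(mulmxA A) mulmxA adjmx_mul X4 Y4 mulmxA
             -(mulmxA Y) -(mulmxA Y) X1.
by rewrite -X2 XAY -mulmxA AXY mulmxA.
Qed.

Definition mpinv m n (A : 'M[C]_(m, n)) : 'M[C]_(n, m) :=
  xchoose (penrose_exists A).

Lemma mpinvP m n (A : 'M[C]_(m, n)) : penrose A (mpinv A).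
Proof. exact: xchooseP. Qed.

(* The orthogonal projector onto the column space of M. *)
Definition orthoproj m n (M : 'M[C]_(m, n)) : 'M[C]_m := M *m mpinv M.

Definition ginv n (A B : 'M[C]_n) : 'M[C]_n := mpinv (A *m B *m mpinv B).

(* Column space, as a set of column vectors; the row space operations of
   [mxalgebra] would describe the range of the transpose instead. *)
Definition mxrange m n (M : 'M[C]_(m, n)) : set 'cV[C]_m :=
  range (fun x : 'cV[C]_n => M *m x).

End MoorePenrose.

(* Main.v *)
Require Import Defs.
From mathcomp Require Import all_boot all_order all_algebra.
From mathcomp Require Import spectral sesquilinear complex.
From mathcomp Require Import classical_sets reals.

(** Write [P := B B^dagger], [M := A P] and [Z := M^dagger].  Everything rests
    on the fact that the range of a Moore-Penrose inverse is the range of the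
    adjoint: [R(Z) = R(M^* ) = R(P A^* )].  Hence [P] fixes [Z], so that
    [A Z = A P Z = M Z] is the orthogonal projector onto [R(M)], and
    [R(M) = R(A B)] because [M = (A B) B^dagger] and [A B = M B].  This gives
    the implications from (a): [Z A Z = Z M Z = Z] and [A Z = P_{AB}].

    Conversely, under (b), [X = X A X = Z A X = Z A Z = Z].  Under (c), both
    [P] and [Z M], the projectors onto [R(B)] and [R(M^* )], fix every vector of
    [R(P A^* )], hence fix [X]; therefore
    [X = Z M X = Z A P X = Z A X = Z P_{AB} = Z M Z = Z]. *)

Section MoorePenroseTheory.
Set Implicit Arguments.
Unset Strict Implicit.
Variable C : numClosedFieldType.
Implicit Types m n p : nat.

Lemma mul_mpinvK m n (M : 'M[C]_(m, n)) : M *m mpinv M *m M = M.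
Proof. by case/and4P: (mpinvP M) => /eqP. Qed.

Lemma mpinv_mulK m n (M : 'M[C]_(m, n)) : mpinv M *m M *m mpinv M = mpinv M.
Proof. by case/and4P: (mpinvP M) => _ /eqP. Qed.

Lemma adjmx_orthoproj m n (M : 'M[C]_(m, n)) :
  (orthoproj M)^t* = orthoproj M.
Proof. by case/and4P: (mpinvP M) => _ _ /eqP. Qed.

Lemma adjmx_mpinv_mul m n (M : 'M[C]_(m, n)) :
  (mpinv M *m M)^t* = mpinv M *m M.
Proof. by case/and4P: (mpinvP M) => _ _ _ /eqP. Qed.

(** The adjoint of [M M^dagger M = M], as [M^dagger M] is self-adjoint: it is
    the projector onto the range of [M^*]. *)
Lemma mpinv_mul_adjK m n (M : 'M[C]_(m, n)) :
  mpinv M *m M *m M^t* = M^t*.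
Proof. by rewrite -adjmx_mpinv_mul -adjmx_mul mulmxA mul_mpinvK. Qed.

(** This factorization shows that [M^dagger] has its range in that of [M^*]. *)
Lemma mpinv_adj_factor m n (M : 'M[C]_(m, n)) :
  mpinv M = M^t* *m ((mpinv M)^t* *m mpinv M).
Proof. by rewrite mulmxA -adjmx_mul adjmx_mpinv_mul mpinv_mulK. Qed.

(** The hypotheses say that [M] and [N] have the same range, so each projector
    fixes the other: [P_N P_M = P_M] and [P_M P_N = P_N].  Taking adjoints
    reverses the product, whence [P_M = P_M P_N = P_N]. *)
Lemma eq_orthoproj m n p (M : 'M[C]_(m, n)) (N : 'M[C]_(m, p)) U V :
  M = N *m U -> N = M *m V -> orthoproj M = orthoproj N.
Proof.
move=> MN NM.
have NMK : orthoproj N *m orthoproj M = orthoproj M.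
  rewrite /orthoproj !mulmxA; congr (_ *m _).
  by rewrite {1}MN mulmxA mul_mpinvK.
have MNK : orthoproj M *m orthoproj N = orthoproj N.
  rewrite /orthoproj !mulmxA; congr (_ *m _).
  by rewrite {1}NM mulmxA mul_mpinvK.
by rewrite -[LHS]adjmx_orthoproj -NMK adjmx_mul !adjmx_orthoproj MNK.
Qed.

Lemma orthoproj_mulmx_mpinv m n p (A : 'M[C]_(m, n)) (B : 'M[C]_(n, p)) :
  orthoproj (A *m B *m mpinv B) = orthoproj (A *m B).
Proof.
apply: (@eq_orthoproj _ _ _ _ _ (mpinv B) B) => //.
by rewrite -!mulmxA [B *m (_ *m _)]mulmxA mul_mpinvK.
Qed.

Lemma adjmx_mul_mpinv m n p (A : 'M[C]_(m, n)) (B : 'M[C]_(n, p)) :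
  (A *m B *m mpinv B)^t* = B *m mpinv B *m A^t*.
Proof. by rewrite -mulmxA adjmx_mul -/(orthoproj B) adjmx_orthoproj. Qed.

Lemma mul_mpinv_adjK m n p (A : 'M[C]_(m, n)) (B : 'M[C]_(n, p)) :
  B *m mpinv B *m (A *m B *m mpinv B)^t* = (A *m B *m mpinv B)^t*.
Proof. by rewrite adjmx_mul_mpinv !mulmxA mul_mpinvK. Qed.

(** The generalized inverse ranges in [R(B B^dagger A^* )], on which
    [B B^dagger] acts as the identity; so [A] and [A B B^dagger] agree on it. *)
Lemma mul_mpinv_mul_mpinv m n p (A : 'M[C]_(m, n)) (B : 'M[C]_(n, p)) :
  A *m mpinv (A *m B *m mpinv B) = orthoproj (A *m B *m mpinv B).
Proof.
have PZ : B *m mpinv B *m mpinv (A *m B *m mpinv B)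
          = mpinv (A *m B *m mpinv B).
  rewrite [mpinv (A *m B *m mpinv B)]mpinv_adj_factor.
  by rewrite [LHS]mulmxA mul_mpinv_adjK.
by rewrite -[in LHS]PZ /orthoproj !mulmxA.
Qed.

Lemma mxrange_mulr m n p (N : 'M[C]_(m, n)) (W : 'M[C]_(n, p)) :
  (mxrange (N *m W) `<=` mxrange N)%classic.
Proof. by move=> _ [x _ <-]; exists (W *m x) => //; rewrite mulmxA. Qed.

(** Checked on columns, which avoids producing a factorization [X = N W] from
    the inclusion of ranges. *)
Lemma mxrange_fixed m n p (K : 'M[C]_m) (N : 'M[C]_(m, n)) (X : 'M[C]_(m, p)) :
  (mxrange X `<=` mxrange N)%classic -> K *m N = N -> K *m X = X.
Proof.
move=> XN KN; apply/matrixP => i j.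
have [|y _ Ny] := XN (col j X); first by exists (delta_mx j 0); rewrite ?colE.
have KXj : col j (K *m X) = col j X by rewrite colE -mulmxA -colE -Ny mulmxA KN.
by have /matrixP/(_ i 0) := KXj; rewrite !mxE.
Qed.

End MoorePenroseTheory.

Theorem theorem4p4 (R : realType) (n : nat) (A B X : 'M[R[i]]_n) :
  (X = ginv A B <->
     [/\ X *m A *m X = X,
         A *m X = A *m mpinv (A *m B *m mpinv B)
       & X *m A = mpinv (A *m B *m mpinv B) *m A]) /\
  (X = ginv A B <->
     A *m X = orthoproj (A *m B) /\
     (mxrange X `<=` mxrange (B *m mpinv B *m A^t* ))%classic).
Proof.
rewrite /ginv -orthoproj_mulmx_mpinv -adjmx_mul_mpinv.
have AZ := mul_mpinv_mul_mpinv A B.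
set M := A *m B *m mpinv B in AZ *.
have ZAZ : mpinv M *m A *m mpinv M = mpinv M.
  by rewrite -mulmxA AZ mulmxA mpinv_mulK.
split; split.
- by move=> ->.
- by case=> XAX AX XA; rewrite -XAX XA -mulmxA AX mulmxA.
- move=> ->; split=> //.
  by rewrite [X in mxrange X]mpinv_adj_factor; apply: mxrange_mulr.
- case=> AX sXM.
  have ZMX : mpinv M *m M *m X = X.
    exact: mxrange_fixed sXM (mpinv_mul_adjK M).
  have PX : B *m mpinv B *m X = X.
    exact: mxrange_fixed sXM (mul_mpinv_adjK A B).
  have MX : M *m X = A *m X by rewrite -[in RHS]PX !mulmxA.
  by rewrite -ZMX -mulmxA MX AX mulmxA mpinv_mulK.
Qed.
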